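(* Let $\Upsilon=\Upsilon(\underline{\psi},\underline{\delta})$ be a triangular $\mathbf{t}$-module of dimension $n$ defined over a field $K$. There exists a finite extension $K(\Upsilon)/K$ such that $\Upsilon$ is isomorphic over $K(\Upsilon)$ to a triangular $\mathbf{t}$-module (its reduced form) $\Upsilon^{\mathrm{red}}=\Upsilon(\underline{\psi}^{\mathrm{red}},\underline{\delta}^{\mathrm{red}})$ defined over $K(\Upsilon)$ satisfying \[\deg_\tau\delta^{\mathrm{red}}_{i\times j}<\max\{\operatorname{rk}\psi_i,\operatorname{rk}\psi_j\}\] for all off-diagonal positions $i\times j$ (i.e. all $i<j$).
   Context: Let $A=\mathbb F_q[t]$, $K$ an $A$-field with $\theta$ the image of $t$, and $K\{\tau\}$ the twisted polynomial ring ($\tau c=c^q\tau$). A $\mathbf{t}$-module of dimension $d$ over $K$ is an $\mathbb F_q$-algebra homomorphism $\Phi:A\to\mathrm{Mat}_d(K\{\tau\})$ with constant term of $\Phi_t$ equal to $\theta I_d+N$, $N$ nilpotent. A Drinfeld module is a $\mathbf{t}$-module $\psi$ of dimension $1$ with $\psi_t=\theta+a_1\tau+\dots+a_r\tau^r$, $a_r\neq0$, $r\ge1$; $\operatorname{rk}\psi=r$. Two $\mathbf{t}$-modules $\Upsilon,\Upsilon'$ of dimension $n$ are isomorphic over a field $L\supseteq K$ if there is $U\in\mathrm{GL}_n(L\{\tau\})$ with $U\Upsilon_tU^{-1}=\Upsilon'_t$. Triangular $\mathbf{t}$-module: index rows and columns of $n\times n$ matrices by $n,n-1,\dots,1$ from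 top to bottom and from left to right. $\Upsilon=\Upsilon(\underline\psi,\underline\delta)$ is the $\mathbf{t}$-module with $\Upsilon_t$ lower triangular, whose diagonal entry at position $(k,k)$ is $\psi_{k,t}$ for Drinfeld modules $\psi_1,\dots,\psi_n$, whose entry in row $i$ and column $j$ with $i<j$ is a twisted polynomial $\delta_{i\times j}\in K\{\tau\}$, and whose other entries are $0$; $\underline\psi=(\psi_1,\dots,\psi_n)$ and $\underline\delta=(\delta_1,\dots,\delta_{n-1})$ with $\delta_l=(\delta_{l\times l+1},\dots,\delta_{1\times l+1})^T$. (Equivalently, $\Upsilon$ has a $\tau$-composition series whose successive subquotients are the Drinfeld modules $\psi_1,\dots,\psi_n$.) *)

(* Defs.v *)
Set Warnings "-notation-overridden,-ambiguous-paths,-redundant-canonical-projection".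
From HB Require Import structures.
From mathcomp Require Import all_boot all_order all_fingroup all_algebra.
From mathcomp Require Import all_solvable all_field.

Set Implicit Arguments.
Unset Strict Implicit.
Unset Printing Implicit Defensive.

Import GRing.Theory.
Local Open Scope ring_scope.

(* The skew polynomial ring R[tau; sigma], with tau * c = sigma c * tau: the   *)
(* underlying additive group is {poly R}, the coefficient of index k standing  *)
(* in front of tau^k.                                                          *)
Definition skewpoly (R : nzRingType) (sigma : {rmorphism R -> R}) := {poly R}.

HB.instance Definition _ (R : nzRingType) (sigma : {rmorphism R -> R}) :=
  GRing.Zmodule.on (skewpoly sigma).

Section SkewPoly.
Variables (R : nzRingType) (sigma : {rmorphism R -> R}).
Implicit Types p q r : {poly R}.

Let s (k : nat) : R -> R := iter k sigma.

Let s0 k : s k 0 = 0.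
Proof. by elim: k => //= k ->; rewrite rmorph0. Qed.

Let s1 k : s k 1 = 1.
Proof. by elim: k => //= k ->; rewrite rmorph1. Qed.

Let sD k : {morph s k : x y / x + y}.
Proof. by move=> x y; elim: k => //= k ->; rewrite rmorphD. Qed.

Let sM k : {morph s k : x y / x * y}.
Proof. by move=> x y; elim: k => //= k ->; rewrite rmorphM. Qed.

Definition skew_mul p q : {poly R} :=
  \poly_(k < (size p + size q).-1)
     (\sum_(i < k.+1) p`_i * iter i sigma q`_(k - i)).

Fact coef_skew_mul p q k :
  (skew_mul p q)`_k = \sum_(i < k.+1) p`_i * iter i sigma q`_(k - i).
Proof.
rewrite coef_poly ltn_predRL; case: leqP => // le_pq_k1.
rewrite big1 // => i _; have [lp_i|lt_i_p] := leqP (size p) i.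
  by rewrite nth_default ?mul0r.
rewrite [q`__]nth_default ?[iter _ _ _]s0 ?mulr0 // leq_subRL -ltnS //.
by rewrite (leq_trans _ le_pq_k1) // ltn_add2r.
Qed.

Fact coef_skew_mul_rev p q k :
  (skew_mul p q)`_k = \sum_(i < k.+1) p`_(k - i) * iter (k - i) sigma q`_i.
Proof.
rewrite coef_skew_mul (reindex_inj rev_ord_inj) /=.
by apply: eq_bigr => i _; rewrite (sub_ordK i).
Qed.

Let ssum k (I : finType) (P : pred I) (E : I -> R) :
  s k (\sum_(i | P i) E i) = \sum_(i | P i) s k (E i).
Proof. exact: (big_morph (s k) (@sD k) (s0 k)). Qed.

Fact skew_mulA : associative skew_mul.
Proof.
move=> p q r; apply/polyP=> i; rewrite coef_skew_mul coef_skew_mul_rev.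
pose coef3 j k := p`_j * (s j q`_(i - j - k) * s (i - k) r`_k).
transitivity (\sum_(j < i.+1) \sum_(k < i.+1 | (k <= i - j)%N) coef3 j k).
  apply: eq_bigr => /= j _; rewrite coef_skew_mul_rev -/(s j _) ssum big_distrr /=.
  rewrite (big_ord_narrow_leq (leq_subr _ _)); apply: eq_bigr => k _ /=.
  rewrite /coef3 sM; congr (_ * (_ * _)).
  have le_ji : (j <= i)%N by rewrite -ltnS.
  have le_k : (k <= i - j)%N by rewrite -ltnS.
  rewrite /s -iterD; congr (iter _ _ _).
  by rewrite addnBA // subnKC.
rewrite (exchange_big_dep predT) //=; apply: eq_bigr => k _.
transitivity (\sum_(j < i.+1 | (j <= i - k)%N) coef3 j k).
  apply: eq_bigl => j; rewrite -ltnS -(ltnS j) -!subSn ?leq_ord //.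
  by rewrite -subn_gt0 -(subn_gt0 j) -!subnDA addnC.
rewrite (big_ord_narrow_leq (leq_subr _ _)) coef_skew_mul big_distrl /=.
by apply: eq_bigr => j _; rewrite /coef3 -!subnDA addnC mulrA.
Qed.

Fact skew_mul1l : left_id 1%:P skew_mul.
Proof.
move=> p; apply/polyP => i; rewrite coef_skew_mul big_ord_recl subn0.
by rewrite big1 => [|j _]; rewrite coefC ?mul1r ?addr0 ?mul0r.
Qed.

Fact skew_mul1r : right_id 1%:P skew_mul.
Proof.
move=> p; apply/polyP => i; rewrite coef_skew_mul_rev big_ord_recl subn0.
rewrite big1 => [|j _]; rewrite coefC -/(s _ _).
  by rewrite s1 mulr1 addr0.
by rewrite s0 mulr0.
Qed.

Fact skew_mulDl : left_distributive skew_mul +%R.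
Proof.
move=> p q r; apply/polyP=> i; rewrite coefD !coef_skew_mul -big_split.
by apply: eq_bigr => j _; rewrite coefD mulrDl.
Qed.

Fact skew_mulDr : right_distributive skew_mul +%R.
Proof.
move=> p q r; apply/polyP=> i; rewrite coefD !coef_skew_mul -big_split.
by apply: eq_bigr => j _; rewrite coefD -/(s _ _) sD mulrDr.
Qed.

Fact skew1_neq0 : 1%:P != 0 :> {poly R}.
Proof. by rewrite polyC_eq0 oner_neq0. Qed.

HB.instance Definition _ := GRing.Zmodule_isNzRing.Build (skewpoly sigma)
  skew_mulA skew_mul1l skew_mul1r skew_mulDl skew_mulDr skew1_neq0.

End SkewPoly.

Section SkewMap.
Variables (R S : nzRingType) (sigma : {rmorphism R -> R}).
Variables (sigma' : {rmorphism S -> S}) (f : {rmorphism R -> S}).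
Hypothesis f_sigma : forall x, f (sigma x) = sigma' (f x).

Definition skew_map of (forall x, f (sigma x) = sigma' (f x)) :
  skewpoly sigma -> skewpoly sigma' :=
  fun p => (map_poly f (p : {poly R}) : {poly S}).

Fact skew_map_is_zmod_morphism : zmod_morphism (skew_map f_sigma).
Proof. by move=> p q; exact: (rmorphB (map_poly f)). Qed.

Fact skew_map_is_monoid_morphism : monoid_morphism (skew_map f_sigma).
Proof.
have fi k x : f (iter k sigma x) = iter k sigma' (f x).
  by elim: k => //= k <-.
split; first exact: (rmorph1 (map_poly f)).
move=> p q; apply/polyP=> k; rewrite coef_map /= !coef_skew_mul rmorph_sum /=.
by apply: eq_bigr => i _; rewrite rmorphM fi !coef_map.
Qed.

HB.instance Definition _ := GRing.isZmodMorphism.Build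
  (skewpoly sigma) (skewpoly sigma') (skew_map f_sigma)
  skew_map_is_zmod_morphism.
HB.instance Definition _ := GRing.isMonoidMorphism.Build
  (skewpoly sigma) (skewpoly sigma') (skew_map f_sigma)
  skew_map_is_monoid_morphism.

End SkewMap.

(* Throughout, F is the finite field F_q, q = #|F|, A = {poly F}, t = 'X, and  *)
(* the A-field structure of a field K is a ring morphism gamma : A -> K; it    *)
(* makes K an F_q-algebra through the constants of A.                          *)
Section AField.
Variables (F : finFieldType) (K : fieldType) (gamma : {rmorphism {poly F} -> K}).

Definition frob of {rmorphism {poly F} -> K} : K -> K := fun x => x ^+ #|F|.

Fact frob_pchar : [pchar K].-nat #|F|.
Proof.
have [p pr_p pF] := finPcharP F.
have pK : p \in [pchar K].
  rewrite inE pr_p /=; have := rmorph_nat (gamma \o polyC) p.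
  by rewrite (pcharf0 pF) rmorph0 => <-.
rewrite (eq_pnat _ (pcharf_eq pK)) -cardsT.
by have /andP[] := fin_ring_pchar_abelem pF.
Qed.

Fact frob_is_zmod_morphism : zmod_morphism (frob gamma).
Proof.
move=> x y; apply: (addIr (frob gamma y)).
by rewrite /frob -(exprDn_pchar _ _ frob_pchar) !subrK.
Qed.

Fact frob_is_monoid_morphism : monoid_morphism (frob gamma).
Proof. by split=> [|x y]; rewrite /frob ?expr1n ?exprMn. Qed.

HB.instance Definition _ :=
  GRing.isZmodMorphism.Build K K (frob gamma) frob_is_zmod_morphism.
HB.instance Definition _ :=
  GRing.isMonoidMorphism.Build K K (frob gamma) frob_is_monoid_morphism.

(* K{tau}, with tau * c = c ^+ q * tau. *)
Definition twpoly := skewpoly (frob gamma).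
HB.instance Definition _ := GRing.NzRing.on twpoly.

Definition tau_coef (k : nat) (p : twpoly) : K := (p : {poly K})`_k.

(* deg_tau 0 is 0 here, not -oo. *)
Definition deg_tau (p : twpoly) : nat := (size (p : {poly K})).-1.

Definition theta : K := gamma 'X.

(* The image in K{tau} of a scalar of F_q. *)
Definition Fq_const (c : F) : twpoly := ((gamma c%:P)%:P : {poly K}).

Record tmodule (d : nat) := TModule {
  tm_hom :> {rmorphism {poly F} -> 'M[twpoly]_d};
  tm_linear : forall (c : F) (a : {poly F}),
    tm_hom (c *: a) = (Fq_const c)%:M *m tm_hom a;
  tm_const : exists N : 'M[K]_d,
    (exists m : nat, N ^+ m = 0) /\
    map_mx (tau_coef 0) (tm_hom 'X) = theta%:M + N
}.

(* Upsilon_t *)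
Definition tm_t (d : nat) (Phi : tmodule d) : 'M[twpoly]_d := Phi 'X.

(* psi_t as an element of K{tau} *)
Definition psi_t (psi : tmodule 1) : twpoly := tm_t psi 0 0.

Record drinfeld := Drinfeld {
  dr_tm :> tmodule 1;
  dr_const : tau_coef 0 (psi_t dr_tm) = theta;
  dr_rank : (0 < deg_tau (psi_t dr_tm))%N
}.

Definition rk (psi : drinfeld) : nat := deg_tau (psi_t psi).

(* The label k + 1 of the decreasing labelling n, ..., 1 of rows and columns   *)
(* is the ordinal k : 'I_n, so that the label of the u-th row (or column) from *)
(* the top (or left) is rev_ord u. Only the values delta i j with i < j        *)
(* matter.                                                                     *)
Definition triangular_mx (n : nat) (psi : 'I_n -> drinfeld)
    (delta : 'I_n -> 'I_n -> twpoly) : 'M[twpoly]_n :=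
  \matrix_(u < n, v < n)
    let i := rev_ord u in let j := rev_ord v in
    if i == j then psi_t (psi i) else if (i < j)%N then delta i j else 0.

(* Ups = Upsilon(psi, delta); a t-module is determined by the image of t. *)
Definition is_triangular (n : nat) (Ups : tmodule n) (psi : 'I_n -> drinfeld)
    (delta : 'I_n -> 'I_n -> twpoly) : Prop :=
  tm_t Ups = triangular_mx psi delta.

(* U is an element of GL_n(K{tau}) with inverse V; unitmx is not available     *)
(* over a noncommutative ring.                                                 *)
Definition tm_isomorphic (n : nat) (Ups Ups' : tmodule n) : Prop :=
  exists U V : 'M[twpoly]_n,
    [/\ U *m V = 1%:M, V *m U = 1%:M & U *m tm_t Ups *m V = tm_t Ups'].

End AField.

Arguments tm_isomorphic {F K gamma n} Ups Ups'.

Section BaseChange.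
Variables (F : finFieldType) (K : fieldType) (gamma : {rmorphism {poly F} -> K}).
Variable L : fieldExtType K.

Definition ext_gamma : {rmorphism {poly F} -> L} := in_alg L \o gamma.

Fact in_alg_frob (x : K) :
  in_alg L (frob gamma x) = frob ext_gamma (in_alg L x).
Proof. exact: rmorphXn. Qed.

Definition tw_ext : twpoly gamma -> twpoly ext_gamma := skew_map in_alg_frob.
HB.instance Definition _ := GRing.RMorphism.on tw_ext.

Variables (d : nat) (Phi : tmodule gamma d).

Definition tm_ext_hom : {rmorphism {poly F} -> 'M[twpoly ext_gamma]_d} :=
  map_mx tw_ext \o Phi.

Fact tm_ext_linear (c : F) (a : {poly F}) :
  tm_ext_hom (c *: a) = (Fq_const ext_gamma c)%:M *m tm_ext_hom a.
Proof.
rewrite /tm_ext_hom /= tm_linear map_mxM map_scalar_mx; congr (_%:M *m _).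
exact: (map_polyC (in_alg L)).
Qed.

Fact tm_ext_const : exists N : 'M[L]_d,
  (exists m : nat, N ^+ m = 0) /\
  map_mx (@tau_coef _ _ ext_gamma 0) (tm_ext_hom 'X) = (theta ext_gamma)%:M + N.
Proof.
have [N [[m Nm] eN]] := tm_const Phi.
exists (map_mx (in_alg L) N); split.
  by exists m; rewrite -rmorphXn Nm rmorph0.
rewrite -[(theta _)%:M](map_scalar_mx (in_alg L)) -map_mxD -eN.
apply/matrixP=> i j; rewrite !mxE.
exact: (coef_map (in_alg L)).
Qed.

Definition tm_ext : tmodule ext_gamma d := TModule tm_ext_linear tm_ext_const.

End BaseChange.

Arguments tm_ext {F K gamma} L {d} Phi.

(* For t-modules over K and over the extension L of K. *)
Definition isomorphic_over (F : finFieldType) (K : fieldType)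
    (gamma : {rmorphism {poly F} -> K}) (L : fieldExtType K) (n : nat)
    (Ups : tmodule gamma n) (Ups' : tmodule (ext_gamma gamma L) n) : Prop :=
  tm_isomorphic (tm_ext L Ups) Ups'.

(* Main.v *)
(* Conjugating by 1 + x E_(u,v), with u > v counted from the top left, replaces *)
(* the entry delta at (u, v) by delta + x psi_v - psi_u x, where psi_u is the   *)
(* diagonal entry at (u, u). Taking x = c tau^m with                            *)
(* deg delta = m + r and r the larger of the two ranks, the coefficient of      *)
(* tau^(m + r) vanishes as soon as c is a root of                               *)
(*     a_v^(q^m) X - a_u X^(q^r) + lead(delta),                                 *)
(* where a_v, a_u are the coefficients of tau^r in psi_v, psi_u. One of them is *)
(* nonzero and q^r > 1, so this polynomial is not constant and has a root in a  *)
(* finite extension. The other entries that change all lie strictly further     *)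
(* from the diagonal, so the entries can be treated one diagonal at a time.     *)

Require Import Defs.
From HB Require Import structures.
From mathcomp Require Import all_boot all_order all_fingroup all_algebra.
From mathcomp Require Import all_solvable all_field.
From mathcomp Require Import zify.
From Stdlib Require Import Classical.
Set Implicit Arguments.
Unset Strict Implicit.
Unset Printing Implicit Defensive.
Import GRing.Theory.
Local Open Scope ring_scope.

(** This is elimination below the diagonal in which each step lowers a degree instead of killing an
    entry. Removing the top coefficient of an entry amounts to solving one polynomial equation in
    one unknown; it is nonconstant because the unknown and its Frobenius power occur in different
    degrees, so a root costs only a finite extension ([adjoin_root]). [reduce_leading_term] removes
    one coefficient, [reduce_entry] iterates this until the degree drops below the larger rank, and
    [reduce_matrix_upto] sweeps through the entries, never undoing earlier work and changing the
    diagonal only by base change. The accumulated matrix [U] is invertible, and [tm_conj] shows that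
    conjugation by it yields a t-module again. *)

(** Unlike [deg_tau], the size separates 0 from the nonzero constants, so size at most [r] means
    degree below [r] for zero as well. *)
Definition tau_size (F : finFieldType) (K : fieldType)
    (g : {rmorphism {poly F} -> K}) (p : twpoly g) : nat := size (p : {poly K}).

(** * Base change of twisted polynomials along a field morphism *)

Section TwMap.
Variables (F : finFieldType) (K L : fieldType).
Variables (g : {rmorphism {poly F} -> K}) (h : {rmorphism {poly F} -> L}).
Variable f : {rmorphism K -> L}.

Fact frob_commute (x : K) : f (frob g x) = frob h (f x).
Proof. exact: rmorphXn. Qed.

(** Any field morphism will do, since it commutes with the [q]-power map; this covers the steps
    [L -> M] of a tower over [K], where [tw_ext] starts from [K]. *)
Definition tw_map : twpoly g -> twpoly h := skew_map frob_commute.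
HB.instance Definition _ := GRing.RMorphism.on tw_map.

Lemma tau_coef_map p k : tau_coef k (tw_map p) = f (tau_coef k p).
Proof. exact: coef_map. Qed.

Lemma tau_size_map p : tau_size (tw_map p) = tau_size p.
Proof. exact: size_map_poly. Qed.

End TwMap.

Arguments tw_map {F K L} g h f p.

(** * Coefficients and degrees in the twisted polynomial ring *)

Section Tau.
Variables (F : finFieldType) (K : fieldType) (g : {rmorphism {poly F} -> K}).
Implicit Types p q : twpoly g.

Lemma twpolyP p q : (forall k, tau_coef k p = tau_coef k q) -> p = q.
Proof. by move=> e; apply/polyP. Qed.

Lemma tau_coefD k p q : tau_coef k (p + q) = tau_coef k p + tau_coef k q.
Proof. exact: coefD. Qed.

Lemma tau_coefN k p : tau_coef k (- p) = - tau_coef k p.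
Proof. exact: coefN. Qed.

Lemma iter_frob i (x : K) : iter i (frob g) x = x ^+ (#|F| ^ i).
Proof. by elim: i => //= i ->; rewrite /frob -exprM expnSr. Qed.

Lemma tau_coefM k p q :
  tau_coef k (p * q) = \sum_(i < k.+1) tau_coef i p * tau_coef (k - i) q ^+ (#|F| ^ i).
Proof.
rewrite /tau_coef coef_skew_mul; apply: eq_bigr => i _; congr (_ * _).
exact: iter_frob.
Qed.

Definition tau_monomial (c : K) (m : nat) : twpoly g := (c *: 'X^m : {poly K}).

Lemma tau_coef_monomial c m k : tau_coef k (tau_monomial c m) = c *+ (k == m).
Proof. by rewrite /tau_coef coefZ coefXn mulr_natr. Qed.

Lemma tau_coef_mul_monomiall c m k p :
  tau_coef (m + k) (tau_monomial c m * p) = c * tau_coef k p ^+ (#|F| ^ m).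
Proof.
rewrite tau_coefM.
have lt_m : (m < (m + k).+1)%N by rewrite ltnS leq_addr.
rewrite (bigD1 (Ordinal lt_m)) //= tau_coef_monomial eqxx addKn.
rewrite big1 ?addr0 // => i; rewrite -val_eqE /= tau_coef_monomial => /negPf ->.
by rewrite mul0r.
Qed.

Lemma tau_coef_mul_monomialr c m k p :
  tau_coef (m + k) (p * tau_monomial c m) = tau_coef k p * c ^+ (#|F| ^ k).
Proof.
rewrite tau_coefM.
have lt_k : (k < (m + k).+1)%N by rewrite ltnS leq_addl.
rewrite (bigD1 (Ordinal lt_k)) //= tau_coef_monomial addnK eqxx.
rewrite big1 ?addr0 // => i; rewrite -val_eqE /= tau_coef_monomial => ne_ik.
have /negPf-> : (m + k - i != m)%N.
  apply: contraNneq ne_ik => e; rewrite -(eqn_add2l m) -{1}e subnK //.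
  by rewrite -ltnS.
(* The remaining summands contain 0 raised to a power of [q], which vanishes because that exponent
   is positive. *)
have q_gt0 := ltnW (finNzRing_gt1 F).
by rewrite mulr0n expr0n gtn_eqF ?mulr0 // expn_gt0 q_gt0.
Qed.

Lemma tau_sizeD p q n :
  (tau_size p <= n)%N -> (tau_size q <= n)%N -> (tau_size (p + q)%R <= n)%N.
Proof.
by move=> sz_p sz_q; rewrite (leq_trans (size_polyD _ _)) // geq_max; apply/andP.
Qed.

Lemma tau_sizeN p : tau_size (- p) = tau_size p.
Proof. exact: size_polyN. Qed.

Lemma tau_sizeM p q : (tau_size (p * q)%R <= (tau_size p + tau_size q).-1)%N.
Proof. exact: size_poly. Qed.

Lemma tau_size_monomial c m : (tau_size (tau_monomial c m) <= m.+1)%N.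
Proof. by rewrite (leq_trans (size_scale_leq _ _)) // size_polyXn. Qed.

Lemma tau_size_leS p n :
  (tau_size p <= n.+1)%N -> tau_coef n p = 0 -> (tau_size p <= n)%N.
Proof.
move=> sz_p p_n; apply/leq_sizeP => k; rewrite leq_eqVlt => /predU1P[<- // |].
by move/leq_sizeP: sz_p; apply.
Qed.

End Tau.

(** * Adjoining a root *)

(** Induction on the size: a reducible polynomial has a nonconstant divisor of smaller size.
    Excluded middle decides irreducibility, as the field is arbitrary. *)
Lemma irreducible_dvd_exists (K : fieldType) (p : {poly K}) :
  (1 < size p)%N -> exists2 r, irreducible_poly r & r %| p.
Proof.
have [m] := ubnP (size p); elim: m p => // m IHm p lt_p_m p_gt1.
have p_neq0 : p != 0 by rewrite -size_poly_gt0 ltnW.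
have [irr_p | red_p] := classic (irreducible_poly p); first by exists p.
have [q] : exists q : {poly K}, [/\ size q != 1, q %| p & ~~ (q %= p)].
  apply: NNPP => no_q; apply: red_p; split=> // q q_n1 dvd_qp.
  by apply: contraT => ne_qp; case: no_q; exists q.
case=> q_n1 dvd_qp ne_qp.
have q_neq0 : q != 0 by apply: contraTneq dvd_qp => ->; rewrite dvd0p.
have q_gt1 : (1 < size q)%N.
  by rewrite ltn_neqAle eq_sym q_n1 size_poly_gt0.
have lt_qp : (size q < size p)%N.
  by rewrite ltn_neqAle dvdp_size_eqp // ne_qp dvdp_leq.
have [r irr_r dvd_rq] := IHm q (leq_trans lt_qp lt_p_m) q_gt1.
by exists r => //; apply: dvdp_trans dvd_rq dvd_qp.
Qed.

(** Adjoin to [L] a root of an irreducible factor and regard the result as an extension of [K]. The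
    first clause says that [f] is the identity on [K]. *)
Lemma adjoin_root (K : fieldType) (L : fieldExtType K) (p : {poly L}) :
  (1 < size p)%N ->
  exists (M : fieldExtType K) (f : {rmorphism L -> M}),
    (forall a : K, f a%:A = a%:A) /\ exists c, root (map_poly f p) c.
Proof.
move=> /irreducible_dvd_exists[r irr_r dvd_rp].
have [M _ [z rz _]] := irredp_FAdjoin irr_r.
exists (baseFieldType M), (in_alg M); split.
  by move=> a; rewrite baseField_scaleE.
exists z; rewrite -dvdp_XsubCl (@dvdp_trans _ (map_poly (in_alg M) r)) //.
  by rewrite dvdp_XsubCl.
by rewrite dvdp_map.
Qed.

(** * Lowering the degree of one entry *)

Section ReduceEntry.
Variables (F : finFieldType) (K : fieldType) (g : {rmorphism {poly F} -> K}).

Notation tw L := (twpoly (ext_gamma g L)).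
Notation twm L M f := (tw_map (ext_gamma g L) (ext_gamma g M) f).

Lemma reduce_leading_term (L : fieldExtType K) (alpha beta delta : tw L) (m r : nat) :
  (0 < r)%N -> (tau_size alpha <= r.+1)%N -> (tau_size beta <= r.+1)%N ->
  (tau_coef r alpha != 0) || (tau_coef r beta != 0) ->
  (tau_size delta <= (m + r).+1)%N ->
  exists (M : fieldExtType K) (f : {rmorphism L -> M}) (x : tw M),
    (forall a : K, f a%:A = a%:A) /\
    (tau_size (twm L M f delta + x * twm L M f alpha - twm L M f beta * x)%R
       <= m + r)%N.
Proof.
move=> r_gt0 sz_alpha sz_beta nz_lead sz_delta.
set a := tau_coef r alpha in nz_lead; set b := tau_coef r beta in nz_lead.
pose q := #|F|; pose P : {poly L} :=
  a ^+ (q ^ m) *: 'X - b *: 'X^(q ^ r) + (tau_coef (m + r) delta)%:P.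
have q_gt1 : (1 < q)%N by exact: finNzRing_gt1.
have qr_gt1 : (1 < q ^ r)%N by rewrite -(exp1n r) ltn_exp2r.
(* Since [r > 0], the degrees 1 and [q ^ r] are distinct and positive, so a constant [P] would force
   both [a] and [b] to vanish. *)
have P_gt1 : (1 < size P)%N.
  rewrite ltnNge; apply: contraL nz_lead => sz_P; rewrite negb_or !negbK.
  have P1 : P`_1 = a ^+ (q ^ m).
    by rewrite !coefE eqxx mulr1 (ltn_eqF qr_gt1) mulr0 subr0 /= addr0.
  have Pr : P`_(q ^ r) = - b.
    rewrite !coefE eqxx (gtn_eqF qr_gt1) (gtn_eqF (ltnW qr_gt1)).
    by rewrite mulr0 mulr1 addr0 sub0r.
  have a0 : a ^+ (q ^ m) = 0 by rewrite -P1 nth_default.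
  have b0 : b = 0.
    by apply/eqP; rewrite -oppr_eq0 -Pr nth_default // (leq_trans sz_P) // ltnW.
  by rewrite b0 eqxx andbT; move/eqP: a0; rewrite expf_eq0 => /andP[].
have [M [f [fK [c rc]]]] := adjoin_root P_gt1.
exists M, f, (tau_monomial _ c m); split=> //.
set x := tau_monomial _ c m.
have sz_x : (tau_size x <= m.+1)%N := tau_size_monomial _ c m.
apply: tau_size_leS.
  apply: tau_sizeD; first apply: tau_sizeD; rewrite ?tau_sizeN ?tau_size_map //;
    by apply: leq_trans (tau_sizeM _ _) _; rewrite tau_size_map; lia.
(* The coefficient of [tau^(m + r)] is the value at [c] of the image of [P] under [f]. *)
rewrite !tau_coefD tau_coefN tau_coef_mul_monomiall tau_coef_mul_monomialr.
rewrite !tau_coef_map -rmorphXn.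
move/rootP: rc; rewrite /P !rmorphD rmorphN /= !map_polyZ map_polyX map_polyXn map_polyC.
rewrite !hornerE /= => rc0; rewrite -[RHS]rc0 -addrA addrC.
by rewrite [c * _]mulrC.
Qed.

(** Each round may enlarge the field, so the induction generalizes over [L] and the three twisted
    polynomials. It runs on a bound [m] for the excess of the size of [delta] over [r]. *)
Lemma reduce_entry (L : fieldExtType K) (alpha beta delta : tw L) (r : nat) :
  (0 < r)%N -> (tau_size alpha <= r.+1)%N -> (tau_size beta <= r.+1)%N ->
  (tau_coef r alpha != 0) || (tau_coef r beta != 0) ->
  exists (M : fieldExtType K) (f : {rmorphism L -> M}) (x : tw M),
    (forall a : K, f a%:A = a%:A) /\
    (tau_size (twm L M f delta + x * twm L M f alpha - twm L M f beta * x)%R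
       <= r)%N.
Proof.
move=> r_gt0 sz_alpha sz_beta nz_lead.
have: (tau_size delta <= tau_size delta + r)%N by exact: leq_addr.
move: {2}(tau_size delta) => m.
elim: m L alpha beta delta sz_alpha sz_beta nz_lead => [|m IHm] L alpha beta delta.
  move=> _ _ _ sz_delta; exists L, idfun, 0; split=> //.
  by rewrite mul0r mulr0 subr0 addr0 tau_size_map.
move=> sz_alpha sz_beta nz_lead /(reduce_leading_term r_gt0 sz_alpha sz_beta nz_lead).
case=> M [f [x [fK sz_delta']]].
case: (IHm M (twm _ _ f alpha) (twm _ _ f beta) _ _ _ _ sz_delta').
- by rewrite tau_size_map.
- by rewrite tau_size_map.
- by rewrite !tau_coef_map !fmorph_eq0.
move=> N [h [y [hK sz_delta'']]].
have twmM p : twm L N (h \o f) p = twm M N h (twm L M f p).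
  by apply: twpolyP => k; rewrite !tau_coef_map.
(* The correction [x * alpha - beta * x] is additive in [x], so successive corrections simply add
   up. *)
exists N, (h \o f), (twm M N h x + y); split=> [a|]; first by rewrite /= fK hK.
rewrite !twmM mulrDl mulrDr; move: sz_delta''.
rewrite rmorphB rmorphD !rmorphM /= opprD !addrA.
by congr (tau_size _ <= _)%N; rewrite -!addrA; congr (_ + (_ + _)); rewrite addrCA.
Qed.

End ReduceEntry.

Lemma mulmx5A (R : nzRingType) (n : nat) (A B C D E : 'M[R]_n) :
  A *m (B *m C *m D) *m E = A *m B *m C *m (D *m E).
Proof. by rewrite !mulmxA. Qed.

(** * Conjugation by elementary matrices *)

Section ElementaryConjugation.
Variables (R : nzRingType) (n : nat) (u v : 'I_n).
Implicit Types (x : R) (A : 'M[R]_n).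

Lemma mul_scale_deltamx x A a b :
  (x *: delta_mx u v *m A) a b = (x * A v b) *+ (a == u).
Proof.
rewrite mxE (bigD1 v) //= big1 => [|k /negPf ne_kv]; rewrite !mxE.
  by rewrite eqxx andbT addr0; case: eqP => _; rewrite ?mulr1 // mulr0 mul0r.
by rewrite ne_kv andbF mulr0 mul0r.
Qed.

Lemma mulmx_scale_delta x A a b :
  (A *m (x *: delta_mx u v)) a b = (A a u * x) *+ (b == v).
Proof.
rewrite mxE (bigD1 u) //= big1 => [|k /negPf ne_ku]; rewrite !mxE.
  by rewrite eqxx addr0; case: eqP => _; rewrite ?mulr1 // !mulr0.
by rewrite ne_ku !mulr0.
Qed.

(** The conjugation is a row operation together with a column operation; their only interaction is
    the quadratic term [x * A v u * x], which the hypothesis kills. *)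
Lemma elementary_conjE x A : A v u = 0 -> forall a b,
  ((1%:M + x *: delta_mx u v) *m A *m (1%:M - x *: delta_mx u v)) a b =
  A a b + (x * A v b) *+ (a == u) - (A a u * x) *+ (b == v).
Proof.
move=> Avu a b; rewrite mulmxBr mulmx1 mulmxDl mul1mx.
have entryB (B C : 'M[R]_n) : (B - C) a b = B a b - C a b by rewrite !mxE.
have entryD (B C : 'M[R]_n) i j : (B + C) i j = B i j + C i j by rewrite mxE.
rewrite entryB mulmx_scale_delta !entryD !mul_scale_deltamx Avu.
by rewrite mulr0 mul0rn addr0.
Qed.

Hypothesis ne_uv : u != v.

(** Squaring to zero is what makes [1 - x E] the inverse of [1 + x E]. *)
Lemma scale_deltamx_sqr x : x *: delta_mx u v *m (x *: delta_mx u v) = 0.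
Proof.
apply/matrixP=> a b; rewrite mul_scale_deltamx !mxE eq_sym (negPf ne_uv).
by rewrite !mulr0 mul0rn.
Qed.

Lemma elementary_mxK x :
  (1%:M + x *: delta_mx u v) *m (1%:M - x *: delta_mx u v) = 1%:M.
Proof.
by rewrite mulmxDl mul1mx mulmxBr mulmx1 scale_deltamx_sqr subr0 subrK.
Qed.

Lemma elementary_mxVK x :
  (1%:M - x *: delta_mx u v) *m (1%:M + x *: delta_mx u v) = 1%:M.
Proof.
by rewrite mulmxBl mul1mx mulmxDr mulmx1 scale_deltamx_sqr addr0 addrK.
Qed.

End ElementaryConjugation.

Lemma lex_pair_leq (m d v d' v' : nat) : (v < m)%N -> (v' < m)%N ->
  (d * m + v <= d' * m + v')%N -> (d < d')%N \/ d = d' /\ (v <= v')%N.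
Proof.
move=> lt_v lt_v' le_dv; have [|lt_d'd|eq_d] := ltngtP d d'; first by left.
  have := leq_mul2r m d'.+1 d; rewrite lt_d'd orbT mulSn; lia.
by right; split=> //; move: le_dv; rewrite eq_d leq_add2l.
Qed.

(** * Sweeping through the entries below the diagonal *)

Section ReduceMatrix.
Variables (F : finFieldType) (K : fieldType) (g : {rmorphism {poly F} -> K}).
Variables (n : nat) (T : 'M[twpoly g]_n) (r : 'I_n -> nat).
Hypothesis r_gt0 : forall u, (0 < r u)%N.
Hypothesis size_diag : forall u, tau_size (T u u) = (r u).+1.
Hypothesis T_low : forall u v : 'I_n, (u < v)%N -> T u v = 0.

(* (u - v) * n + v numbers the entries below the diagonal, one diagonal after  *)
(* the other.                                                                  *)
Lemma reduce_matrix_upto (k : nat) :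
  exists (L : fieldExtType K) (U V T' : 'M[twpoly (ext_gamma g L)]_n),
  [/\ U *m V = 1%:M /\ V *m U = 1%:M,
      T' = U *m map_mx (tw_map g (ext_gamma g L) (in_alg L)) T *m V,
      forall u v : 'I_n, (u < v)%N -> T' u v = 0,
      forall u, T' u u = tw_map g (ext_gamma g L) (in_alg L) (T u u) &
      forall u v : 'I_n, (v < u)%N -> ((u - v) * n + v < k)%N ->
        (tau_size (T' u v) <= maxn (r u) (r v))%N].
Proof.
elim: k => [|k [L [U [V [T1 [[UV VU] T1E T1_low T1_diag T1_red]]]]]].
  exists K^o, 1%:M, 1%:M, (map_mx (tw_map g (ext_gamma g K^o) (in_alg K^o)) T).
  split=> // [||u v lt_uv|u]; rewrite ?mulmx1 ?mul1mx //.
    by rewrite mxE T_low ?rmorph0.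
  by rewrite mxE.
(* Some numbers belong to no entry below the diagonal; for these nothing is to be done. *)
have [/existsP[u /existsP[v /andP[lt_vu /eqP uv_k]]] | no_uv] :=
  boolP [exists u : 'I_n, exists v : 'I_n,
           (v < u)%N && ((u - v) * n + v == k)%N]; last first.
  exists L, U, V, T1; split=> // a b lt_ba; rewrite ltnS leq_eqVlt.
  case/predU1P => [ab_k | ]; last exact: T1_red.
  case/negP: no_uv; apply/existsP; exists a; apply/existsP; exists b.
  by rewrite lt_ba ab_k eqxx.
have sz_diag1 w : tau_size (T1 w w) = (r w).+1.
  by rewrite T1_diag tau_size_map size_diag.
have lead1 w : tau_coef (r w) (T1 w w) != 0.
  have:= sz_diag1 w; rewrite /tau_size /tau_coef => sz_w.
  by rewrite -[r w]/((r w).+1.-1) -sz_w lead_coef_eq0 -size_poly_gt0 sz_w.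
have [|||| M [f [x [fK red_uv]]]] :=
  @reduce_entry F K g L (T1 v v) (T1 u u) (T1 u v) (maxn (r u) (r v)).
- by rewrite leq_max r_gt0.
- by rewrite sz_diag1 ltnS leq_maxr.
- by rewrite sz_diag1 ltnS leq_maxl.
(* The maximum is one of the two ranks, and the diagonal entry of that rank has a nonzero
   coefficient there. *)
- by case: leqP => _; rewrite lead1 ?orbT.
pose fT : {rmorphism twpoly (ext_gamma g L) -> twpoly (ext_gamma g M)} :=
  tw_map (ext_gamma g L) (ext_gamma g M) f.
have ne_uv : u != v by apply: contraTneq lt_vu => ->; rewrite ltnn.
have T1vu : T1 v u = 0 by apply: T1_low.
pose T2 := (1%:M + x *: delta_mx u v) *m map_mx fT T1 *m (1%:M - x *: delta_mx u v).
have T2E a b : T2 a b =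
    fT (T1 a b) + (x * fT (T1 v b)) *+ (a == u) - (fT (T1 a u) * x) *+ (b == v).
  by rewrite elementary_conjE ?mxE ?T1vu ?rmorph0 // !mxE.
exists M, ((1%:M + x *: delta_mx u v) *m map_mx fT U),
  (map_mx fT V *m (1%:M - x *: delta_mx u v)), T2; split.
- split; rewrite mulmxA.
    rewrite -(mulmxA _ (map_mx fT U)) -map_mxM UV map_mx1 mulmx1.
    exact: elementary_mxK.
  rewrite -(mulmxA _ _ (1%:M + _)) elementary_mxVK // mulmx1.
  by rewrite -map_mxM VU map_mx1.
(* As [f] fixes [K], base change through [L] agrees with direct base change to [M]. *)
- have fTE : map_mx fT (map_mx (tw_map g (ext_gamma g L) (in_alg L)) T) =
      map_mx (tw_map g (ext_gamma g M) (in_alg M)) T.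
    apply/matrixP=> a b; rewrite !mxE; apply: twpolyP => i.
    by rewrite !tau_coef_map; exact: fK.
  by rewrite /T2 T1E !(map_mxM fT) fTE; exact: mulmx5A.
- move=> a b lt_ab; rewrite T2E T1_low // rmorph0 add0r.
  have [ab_u|ne_au] := eqVneq a u; first subst a.
    have /negPf-> : b != v.
      by apply: contraTneq lt_ab => ->; rewrite -leqNgt ltnW.
    by rewrite subr0 T1_low ?rmorph0 ?mulr0 ?mul0rn // (ltn_trans lt_vu).
  rewrite sub0r; have [bv|ne_bv] := eqVneq b v; last by rewrite oppr0.
  subst b; rewrite T1_low ?rmorph0 ?mul0r ?oppr0 //.
  exact: ltn_trans lt_ab lt_vu.
- move=> w; rewrite T2E.
  have -> : (x * fT (T1 v w)) *+ (w == u) = 0.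
    by case: eqP => [->|]; rewrite ?mulr0n // T1vu rmorph0 mulr0.
  have -> : (fT (T1 w u) * x) *+ (w == v) = 0.
    by case: eqP => [->|]; rewrite ?mulr0n // T1vu rmorph0 mul0r.
  rewrite addr0 subr0 T1_diag; apply: twpolyP => i; rewrite !tau_coef_map; exact: fK.
move=> a b lt_ba; rewrite ltnS leq_eqVlt => ab_k.
have [/andP[/eqP au /eqP bv] | ne_ab] := boolP ((a == u) && (b == v)).
  by subst a b; rewrite T2E !eqxx !mulr1n.
have le_ab : ((a - b) * n + b <= (u - v) * n + v)%N.
  by rewrite uv_k; case/predU1P: ab_k => [->|/ltnW].
have lex_ab := lex_pair_leq (ltn_ord b) (ltn_ord v) le_ab.
(* Only row [u] and column [v] can change. An entry [(u, b)] numbered no later than [(u, v)] and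
   distinct from it has [v < b], so [T1 v b = 0]; an entry [(a, v)] likewise has [a < u], so
   [T1 a u = 0]. *)
have -> : T2 a b = fT (T1 a b).
  rewrite T2E.
  have -> : (x * fT (T1 v b)) *+ (a == u) = 0.
    case: eqP => [au|]; rewrite ?mulr0n // mulr1n.
    suff lt_vb : (v < b)%N by rewrite T1_low ?rmorph0 ?mulr0.
    subst a; move: ne_ab; rewrite eqxx -val_eqE /=.
    by case: lex_ab; lia.
  have -> : (fT (T1 a u) * x) *+ (b == v) = 0.
    case: eqP => [bv|]; rewrite ?mulr0n // mulr1n.
    suff lt_au : (a < u)%N by rewrite T1_low ?rmorph0 ?mul0r.
    subst b; move: ne_ab; rewrite eqxx andbT -val_eqE /=.
    by case: lex_ab; lia.
  by rewrite addr0 subr0.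
rewrite tau_size_map; apply: T1_red => //.
(* The numbering is injective below the diagonal, so only [(u, v)] has number [k]. *)
case/predU1P: ab_k => // ab_k; case/negP: ne_ab; rewrite -!val_eqE /=.
have le_uv : ((u - v) * n + v <= (a - b) * n + b)%N by rewrite uv_k ab_k.
have lex_uv := lex_pair_leq (ltn_ord v) (ltn_ord b) le_uv.
by case: lex_ab; case: lex_uv; lia.
Qed.

End ReduceMatrix.

(** * The conjugate of a t-module *)

Section ConjugateTModule.
Variables (F : finFieldType) (K : fieldType) (g : {rmorphism {poly F} -> K}).

(** A name for [tau_coef 0] that can carry its ring morphism structure, so that identities between
    matrices over the twisted ring descend to [K]. *)
Definition const_coef (p : twpoly g) : K := tau_coef 0 p.

Fact const_coef_is_zmod_morphism : zmod_morphism const_coef.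
Proof. by move=> p q; rewrite /const_coef tau_coefD tau_coefN. Qed.

Fact const_coef_is_monoid_morphism : monoid_morphism const_coef.
Proof.
split=> [|p q]; first exact: coefC.
by rewrite /const_coef tau_coefM big_ord_recl big_ord0 addr0.
Qed.

HB.instance Definition _ := GRing.isZmodMorphism.Build (twpoly g) K const_coef
  const_coef_is_zmod_morphism.
HB.instance Definition _ := GRing.isMonoidMorphism.Build (twpoly g) K const_coef
  const_coef_is_monoid_morphism.

(** Every power of Frobenius fixes the scalars of [F], so they commute with [tau] as well as with
    [K]. *)
Lemma Fq_const_central (c : F) (p : twpoly g) : Fq_const g c * p = p * Fq_const g c.
Proof.
have -> : Fq_const g c = tau_monomial g (g c%:P) 0.
  by rewrite /tau_monomial expr0 alg_polyC.
apply: twpolyP => k; rewrite -[k]add0n.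
rewrite tau_coef_mul_monomiall tau_coef_mul_monomialr expn0 expr1 mulrC.
congr (_ * _); elim: k => [|k IHk]; first by rewrite expn0 expr1.
by rewrite expnSr exprM -IHk -rmorphXn -polyC_exp expf_card.
Qed.

Variables (d : nat) (U V : 'M[twpoly g]_d).

Lemma Fq_const_mxC (c : F) (A : 'M[twpoly g]_d) :
  A *m (Fq_const g c)%:M = (Fq_const g c)%:M *m A.
Proof.
apply/matrixP=> i j; rewrite mul_scalar_mx !mxE (bigD1 j) //= big1 => [|k ne_kj].
  by rewrite mxE eqxx addr0 Fq_const_central.
by rewrite mxE (negPf ne_kj) mulr0.
Qed.

Hypotheses (UV : U *m V = 1%:M) (VU : V *m U = 1%:M).
Variable Phi : tmodule g d.

Definition conj_hom (a : {poly F}) : 'M[twpoly g]_d := U *m Phi a *m V.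

Fact conj_hom_is_zmod_morphism : zmod_morphism conj_hom.
Proof. by move=> a b; rewrite /conj_hom rmorphB mulmxBr mulmxBl. Qed.

Fact conj_hom_is_monoid_morphism : monoid_morphism conj_hom.
Proof.
split=> [|a b]; first by rewrite /conj_hom rmorph1 mulmx1.
rewrite /conj_hom rmorphM -[RHS]/(_ *m _) -[_ * _]/(_ *m _).
by rewrite -!mulmxA (mulmxA V) VU mul1mx.
Qed.

HB.instance Definition _ := GRing.isZmodMorphism.Build {poly F} 'M[twpoly g]_d
  conj_hom conj_hom_is_zmod_morphism.
HB.instance Definition _ := GRing.isMonoidMorphism.Build {poly F} 'M[twpoly g]_d
  conj_hom conj_hom_is_monoid_morphism.

Fact conj_hom_linear (c : F) (a : {poly F}) :
  conj_hom (c *: a) = (Fq_const g c)%:M *m conj_hom a.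
Proof.
by rewrite /conj_hom tm_linear mulmxA Fq_const_mxC -!mulmxA.
Qed.

(** The constant terms [U0] and [V0] are mutually inverse, so [theta + N] becomes [theta + U0 N V0],
    whose second term is again nilpotent. *)
Fact conj_hom_const : exists N : 'M[K]_d,
  (exists m : nat, N ^+ m = 0) /\
  map_mx (@tau_coef _ _ g 0) (conj_hom 'X) = (theta g)%:M + N.
Proof.
have [N [[m Nm] eN]] := tm_const Phi.
pose U0 := map_mx const_coef U; pose V0 := map_mx const_coef V.
have UV0 : U0 *m V0 = 1%:M by rewrite -map_mxM UV map_mx1.
have VU0 : V0 *m U0 = 1%:M by rewrite -map_mxM VU map_mx1.
exists (U0 *m N *m V0); split.
  exists m; suff -> : (U0 *m N *m V0) ^+ m = U0 *m N ^+ m *m V0.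
    by rewrite Nm mulmx0 mul0mx.
  elim: (m) => [|k IHk]; first by rewrite !expr0 mulmx1.
  rewrite !exprS IHk -[LHS]/(_ *m _) -[N * _]/(_ *m _).
  by rewrite -!mulmxA (mulmxA V0) VU0 mul1mx.
rewrite -[map_mx _ _]/(map_mx const_coef _) !map_mxM.
rewrite -[map_mx _ (Phi 'X)]/(map_mx (@tau_coef _ _ g 0) _) eN.
by rewrite mulmxDr mulmxDl scalar_mxC -(mulmxA (theta g)%:M) UV0 mulmx1.
Qed.

Definition tm_conj : tmodule g d := TModule conj_hom_linear conj_hom_const.

End ConjugateTModule.

(** * Base change of a Drinfeld module *)

Section ExtendDrinfeld.
Variables (F : finFieldType) (K : fieldType) (g : {rmorphism {poly F} -> K}).
Variables (L : fieldExtType K).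

Lemma tw_extE (p : twpoly g) : tw_ext L p = tw_map g (ext_gamma g L) (in_alg L) p.
Proof. exact/twpolyP. Qed.

Lemma psi_t_ext (psi : tmodule g 1) : psi_t (tm_ext L psi) = tw_ext L (psi_t psi).
Proof. by rewrite /psi_t /tm_t /= mxE. Qed.

Variable psi : drinfeld g.

Fact dr_ext_const : tau_coef 0 (psi_t (tm_ext L psi)) = theta (ext_gamma g L).
Proof. by rewrite psi_t_ext tw_extE tau_coef_map dr_const. Qed.

Fact dr_ext_rank : (0 < deg_tau (psi_t (tm_ext L psi)))%N.
Proof.
by rewrite psi_t_ext tw_extE /deg_tau -[size _]/(tau_size _) tau_size_map dr_rank.
Qed.

Definition dr_ext : drinfeld (ext_gamma g L) := Drinfeld dr_ext_const dr_ext_rank.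

End ExtendDrinfeld.

Theorem theorem4p3 (F : finFieldType) (K : fieldType)
    (gamma : {rmorphism {poly F} -> K}) (n : nat)
    (Ups : tmodule gamma n) (psi : 'I_n -> drinfeld gamma)
    (delta : 'I_n -> 'I_n -> twpoly gamma) :
  is_triangular Ups psi delta ->
  exists (L : fieldExtType K)
         (Ups_red : tmodule (ext_gamma gamma L) n)
         (psi_red : 'I_n -> drinfeld (ext_gamma gamma L))
         (delta_red : 'I_n -> 'I_n -> twpoly (ext_gamma gamma L)),
    [/\ is_triangular Ups_red psi_red delta_red,
        isomorphic_over Ups Ups_red &
        forall i j : 'I_n, (i < j)%N ->
          (deg_tau (delta_red i j) < maxn (rk (psi i)) (rk (psi j)))%N].
Proof.
move=> tri; pose r (u : 'I_n) := rk (psi (rev_ord u)).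
have r_gt0 u : (0 < r u)%N by exact: dr_rank.
have diagE u : tm_t Ups u u = psi_t (psi (rev_ord u)) by rewrite tri mxE /= eqxx.
have size_diag u : tau_size (tm_t Ups u u) = (r u).+1.
  by rewrite diagE; have := r_gt0 u; rewrite /r /rk /deg_tau /tau_size; lia.
have lt_rev (u v : 'I_n) : (rev_ord u < rev_ord v)%N = (v < u)%N.
  by rewrite /=; have := ltn_ord u; have := ltn_ord v; lia.
have low (u v : 'I_n) : (u < v)%N -> tm_t Ups u v = 0.
  move=> lt_uv; rewrite tri mxE; cbv zeta; rewrite lt_rev ltnNge (ltnW lt_uv) ifN //.
  by rewrite (inj_eq rev_ord_inj); apply: contraTneq lt_uv => ->; rewrite ltnn.
(* Every entry has number [(u - v) * n + v] below [n * n + n], so this bound covers the whole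
   matrix. *)
have [L [U [V [T [[UV VU] TE T_low T_diag T_red]]]]] :=
  reduce_matrix_upto r_gt0 size_diag low (n * n + n).
exists L, (tm_conj UV VU (tm_ext L Ups)), (fun i => dr_ext L (psi i)),
  (fun i j => T (rev_ord i) (rev_ord j)).
have redE : tm_t (tm_conj UV VU (tm_ext L Ups)) = T.
  rewrite TE; congr (_ *m _ *m _); apply/matrixP=> a b; rewrite !mxE; exact: tw_extE.
split.
- rewrite /is_triangular redE; apply/matrixP=> a b; rewrite mxE; cbv zeta.
  rewrite !rev_ordK.
  rewrite (inj_eq rev_ord_inj) lt_rev.
  have [<-|ne_ab] := eqVneq a b; first by rewrite T_diag diagE psi_t_ext tw_extE.
  have [//|lt_ab|eq_ab] := ltngtP b a; first exact: T_low.
  by case/eqP: ne_ab; apply: val_inj.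
- by exists U, V; split.
move=> i j lt_ij; have lt_ji : (rev_ord j < rev_ord i)%N by rewrite lt_rev.
have lt_idx : ((rev_ord i - rev_ord j) * n + rev_ord j < n * n + n)%N.
  have := ltn_ord (rev_ord j); have := leq_mul2r n (rev_ord i - rev_ord j) n.
  by rewrite (leq_trans (leq_subr _ _) (ltnW (ltn_ord _))) orbT; lia.
have := T_red _ _ lt_ji lt_idx; rewrite /r !rev_ordK.
(* [deg_tau] is a truncated predecessor, so for a zero entry the strict bound relies on the ranks
   being positive. *)
have : (0 < maxn (rk (psi i)) (rk (psi j)))%N by rewrite leq_max dr_rank.
rewrite /deg_tau /tau_size; lia.
Qed.
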